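(* Let $R>0$, $a>0$, $\lambda_1\in\mathbb R\setminus\{0\}$, and consider the equations of motion of a circular cylinder and one point vortex in a perfect fluid (written out in the context). Suppose that $\lambda\ne0$. Then for each periodic solution of the reduced system, i.e. for each solution of the equations of motion along which the reduced variables $$p_1=a(x_1v_1+y_1v_2),\qquad p_2=a(x_1v_2-y_1v_1),\qquad \rho=x_1^2+y_1^2$$ are periodic functions of time (with a common period), there exists a coordinate frame with origin at the center of vorticity, rotating with constant angular velocity, such that with respect to this frame the vortex and the cylinder move along closed curves, i.e. the coordinates in this frame of the cylinder's center (at $\mathbf r_c$) and of the vortex (at $\mathbf r_c+\mathbf r_1$) are periodic functions of time.
   Context: Setting: a cylinder (disk) of radius $R$ in the plane with center $\mathbf r_c=(x_c,y_c)$ (in a fixed frame) and velocity $\mathbf v=(v_1,v_2)$; $\mathbf r_1=(x_1,y_1)$ is the vector from the center of the cylinder to the vortex; $\tilde{\mathbf r}_1=(\tilde x_1,\tilde y_1)=\frac{R^2}{|\mathbf r_1|^2}\mathbf r_1$ is the vector from the center of the cylinder to the inverse point. The constants are $a$ (involving the added mass), $\lambda$ (related to the circulation around the cylinder) and $\lambda_1$ (vortex strength). Phase space: $M=\{(x_c,y_c,v_1,v_2,x_1,y_1)\in\mathbb R^{6}: |\mathbf r_1|>R\}$. Let, for $\mathbf r=(x,y)$ with $|\mathbf r|>R$ (multivalued, but with single-valued gradient), $$\tilde\varphi_1(\mathbf r)=-\frac{R^2}{|\mathbf r|^2}(\mathbf r,\mathbf v)-\lambda\arctan\frac yx+\lambda_1\arctan\frac{y-\tilde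 y_1}{x-\tilde x_1}$$ (the part of the velocity potential without singularity at $\mathbf r=\mathbf r_1$; the gradient is taken in $\mathbf r$ with $\tilde{\mathbf r}_1$ fixed). Equations of motion: $$\dot{\mathbf r}_1=-\mathbf v+\operatorname{grad}\tilde\varphi_1\big|_{\mathbf r=\mathbf r_1},\qquad \dot{\mathbf r}_c=\mathbf v,$$ $$a\dot v_1=\lambda v_2-\lambda_1(\dot{\tilde y}_1-\dot y_1),\qquad a\dot v_2=-\lambda v_1+\lambda_1(\dot{\tilde x}_1-\dot x_1),$$ where $\dot{\tilde x}_1,\dot{\tilde y}_1$ are time derivatives of $\tilde x_1,\tilde y_1$, expressed through $\mathbf r_1$ and $\dot{\mathbf r}_1$. First integrals: $Q=av_2+\lambda x_c-\lambda_1(\tilde x_1-x_1)$ and $P=av_1-\lambda y_c+\lambda_1(\tilde y_1-y_1)$. For $\lambda\ne0$, the center of vorticity of a solution is the fixed point of the plane such that, when the origin of the fixed frame is placed there, $P=Q=0$; explicitly it is the point $(Q/\lambda,-P/\lambda)$. Reduced system: the variables $p_1,p_2,\rho$ are invariant under rotations and evolve by a closed autonomous system of ODEs induced by the equations of motion; this is the reduced system. *)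

(* Defs.v *)
From Stdlib Require Import Reals.
From Coquelicot Require Import Coquelicot.
Open Scope R_scope.

(** [(xc, yc)]: center of the cylinder in the fixed frame; [(v1, v2)]: its
    velocity; [(x1, y1)]: vector from the center of the cylinder to the vortex. *)
Record state := mkState {
  xc : R; yc : R; v1 : R; v2 : R; x1 : R; y1 : R }.

Definition in_phase_space (Rad : R) (s : state) : Prop :=
  sqrt (x1 s ^ 2 + y1 s ^ 2) > Rad.

Definition inv_x (Rad : R) (s : state) : R :=
  Rad ^ 2 / (x1 s ^ 2 + y1 s ^ 2) * x1 s.
Definition inv_y (Rad : R) (s : state) : R :=
  Rad ^ 2 / (x1 s ^ 2 + y1 s ^ 2) * y1 s.

(** The multivalued function [arctan (y/x)], as a function of [(x, y)]: a branch
    that is smooth near every point [(x0, y0) <> (0, 0)]. On the line [x0 = 0],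
    where the quotient [y/x] is not defined, the branch is
    [PI/2 - arctan (x/y)]. Branches differ by local constants, so the gradient
    does not depend on the choice. *)
Definition arctan_branch (x0 x y : R) : R :=
  if Req_EM_T x0 0 then PI / 2 - atan (x / y) else atan (y / x).

(** The regular part of the velocity potential as a function of [(x, y)], the
    state [s] (hence the inverse point) being fixed; the branches of the
    arctangents are those smooth near the vortex, [(x, y) = (x1 s, y1 s)]. *)
Definition phi_tilde (Rad lam lam1 : R) (s : state) (x y : R) : R :=
  - (Rad ^ 2 / (x ^ 2 + y ^ 2)) * (x * v1 s + y * v2 s)
  - lam * arctan_branch (x1 s) x y
  + lam1 * arctan_branch (x1 s - inv_x Rad s) (x - inv_x Rad s) (y - inv_y Rad s).

Definition grad_phi_x (Rad lam lam1 : R) (s : state) : R :=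
  Derive (fun x => phi_tilde Rad lam lam1 s x (y1 s)) (x1 s).
Definition grad_phi_y (Rad lam lam1 : R) (s : state) : R :=
  Derive (fun y => phi_tilde Rad lam lam1 s (x1 s) y) (y1 s).

Record is_solution (Rad a lam lam1 : R) (s : R -> state) : Prop := {
  sol_phase : forall t, in_phase_space Rad (s t);
  sol_x1 : forall t, is_derive (fun u => x1 (s u)) t
             (- v1 (s t) + grad_phi_x Rad lam lam1 (s t));
  sol_y1 : forall t, is_derive (fun u => y1 (s u)) t
             (- v2 (s t) + grad_phi_y Rad lam lam1 (s t));
  sol_xc : forall t, is_derive (fun u => xc (s u)) t (v1 (s t));
  sol_yc : forall t, is_derive (fun u => yc (s u)) t (v2 (s t));
  sol_v1_ex : forall t, ex_derive (fun u => v1 (s u)) t;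
  sol_v2_ex : forall t, ex_derive (fun u => v2 (s u)) t;
  sol_v1 : forall t, a * Derive (fun u => v1 (s u)) t =
             lam * v2 (s t)
             - lam1 * (Derive (fun u => inv_y Rad (s u)) t
                       - Derive (fun u => y1 (s u)) t);
  sol_v2 : forall t, a * Derive (fun u => v2 (s u)) t =
             - lam * v1 (s t)
             + lam1 * (Derive (fun u => inv_x Rad (s u)) t
                       - Derive (fun u => x1 (s u)) t) }.

Definition integral_Q (Rad a lam lam1 : R) (s : state) : R :=
  a * v2 s + lam * xc s - lam1 * (inv_x Rad s - x1 s).
Definition integral_P (Rad a lam lam1 : R) (s : state) : R :=
  a * v1 s - lam * yc s + lam1 * (inv_y Rad s - y1 s).

(** The same state in the fixed frame with origin moved to [O]. *)
Definition move_origin (O : R * R) (s : state) : state :=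
  mkState (xc s - fst O) (yc s - snd O) (v1 s) (v2 s) (x1 s) (y1 s).

(** When [lam <> 0], the only such [O] is [(Q / lam, - P / lam)]. *)
Definition is_center_of_vorticity (Rad a lam lam1 : R) (s : R -> state)
    (O : R * R) : Prop :=
  forall t, integral_P Rad a lam lam1 (move_origin O (s t)) = 0 /\
            integral_Q Rad a lam lam1 (move_origin O (s t)) = 0.

Definition red_p1 (a : R) (s : state) : R := a * (x1 s * v1 s + y1 s * v2 s).
Definition red_p2 (a : R) (s : state) : R := a * (x1 s * v2 s - y1 s * v1 s).
Definition red_rho (s : state) : R := x1 s ^ 2 + y1 s ^ 2.

Definition cylinder_pos (s : state) : R * R := (xc s, yc s).
Definition vortex_pos (s : state) : R * R := (xc s + x1 s, yc s + y1 s).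

(** Coordinates at time [t] of the point [q] of the plane in the frame with
    origin [O] whose axes are turned by the angle [omega * t]. *)
Definition rotating_coords (O : R * R) (omega t : R) (q : R * R) : R * R :=
  (  cos (omega * t) * (fst q - fst O) + sin (omega * t) * (snd q - snd O),
   - sin (omega * t) * (fst q - fst O) + cos (omega * t) * (snd q - snd O)).

Definition periodic {A : Type} (T : R) (f : R -> A) : Prop :=
  0 < T /\ forall t, f (t + T) = f t.

(* Main.v *)
Require Import Defs.
From Stdlib Require Import Reals Lra.
From Coquelicot Require Import Coquelicot.
Open Scope R_scope.

(** In complex notation [z = x1 + i y1], [w = v1 + i v2], the equation for the
    vortex reads [z' = (alpha + i beta) z], where [alpha] and [beta] depend only on
    [p1], [p2], [rho]. If these have period [T], then [z (t + T) / z t] has zero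
    derivative and modulus 1, so it is a constant [exp (i theta)]. The velocity is
    [w = z (p1 + i p2) / (a rho)], and [P = Q = 0] expresses the position relative
    to the center of vorticity through [z] and [w]; hence all these vectors turn by
    [theta] in the time [T], and the frame with angular velocity [theta / T] works. *)

(** * Angles, constant functions and arctangent branches *)

Lemma unit_circle_angle (c d : R) :
  c ^ 2 + d ^ 2 = 1 -> exists theta, cos theta = c /\ sin theta = d.
Proof.
  intros H.
  assert (Hc : -1 <= c <= 1) by nra.
  assert (Hs : sqrt (1 - c²) = Rabs d).
  { rewrite <- sqrt_Rsqr_abs. f_equal. unfold Rsqr. lra. }
  (* [acos c] has nonnegative sine, so the sign of [d] decides between [acos c] and its opposite. *)
  destruct (Rle_dec 0 d) as [Hd | Hd].
  - exists (acos c). rewrite cos_acos, sin_acos, Hs by assumption.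
    split; [reflexivity | now apply Rabs_pos_eq].
  - exists (- acos c). rewrite cos_neg, sin_neg, cos_acos, sin_acos, Hs by assumption.
    split; [reflexivity | rewrite Rabs_left; lra].
Qed.

Lemma derive_zero_constant (f : R -> R) :
  (forall t, is_derive f t 0) -> forall t u, f t = f u.
Proof.
  intros H t u.
  destruct (MVT_gen f t u (fun _ => 0)) as [c [_ Hc]].
  - intros x _. apply H.
  - intros x _. apply continuity_pt_filterlim.
    apply (ex_derive_continuous f x). exists 0. apply H.
  - lra.
Qed.

Lemma pow2_sum_neq_0 (x y : R) : x ^ 2 + y ^ 2 <> 0 -> x = 0 -> y <> 0.
Proof. intros H Hx Hy. apply H. subst. ring. Qed.

(** Both branches give the same formula. On the line [x = 0] the point is not the origin, so
    [y <> 0] and [x / y] is smooth there. *)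
Lemma is_derive_arctan_branch_x (x y : R) :
  x ^ 2 + y ^ 2 <> 0 ->
  is_derive (fun u => arctan_branch x u y) x (- y / (x ^ 2 + y ^ 2)).
Proof.
  intros H. unfold arctan_branch. destruct (Req_EM_T x 0) as [Hx | Hx].
  - pose proof (pow2_sum_neq_0 x y H Hx) as Hy.
    auto_derive; [tauto |]. field. auto.
  - auto_derive; [tauto |]. field. auto.
Qed.

Lemma is_derive_arctan_branch_y (x y : R) :
  x ^ 2 + y ^ 2 <> 0 ->
  is_derive (fun u => arctan_branch x x u) y (x / (x ^ 2 + y ^ 2)).
Proof.
  intros H. unfold arctan_branch. destruct (Req_EM_T x 0) as [Hx | Hx].
  - pose proof (pow2_sum_neq_0 x y H Hx) as Hy.
    auto_derive; [tauto |]. field. auto.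
  - auto_derive; [tauto |]. field. auto.
Qed.

Lemma phase_space_rho (Rad : R) (s : state) :
  0 < Rad -> in_phase_space Rad s -> Rad ^ 2 < red_rho s.
Proof.
  unfold in_phase_space, red_rho. intros HR H.
  assert (H0 : 0 <= x1 s ^ 2 + y1 s ^ 2) by nra.
  rewrite <- (pow2_sqrt _ H0). nra.
Qed.

(** * Gradient of the regular potential at the vortex *)

Section Gradient.

Variables (Rad lam lam1 : R) (s : state).
Hypotheses (HRad : 0 < Rad) (Hphase : in_phase_space Rad s).

(** The inverse point is [Rad^2 / rho] times the vortex vector, so the difference is that vector
    scaled by [1 - Rad^2 / rho]. *)
Lemma inv_diff_norm :
  (x1 s - inv_x Rad s) ^ 2 + (y1 s - inv_y Rad s) ^ 2
  = (red_rho s - Rad ^ 2) ^ 2 / red_rho s.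
Proof.
  pose proof (phase_space_rho _ _ HRad Hphase) as H.
  unfold inv_x, inv_y, red_rho in *. field. nra.
Qed.

Lemma inv_diff_norm_neq_0 :
  (x1 s - inv_x Rad s) ^ 2 + (y1 s - inv_y Rad s) ^ 2 <> 0.
Proof.
  pose proof (phase_space_rho _ _ HRad Hphase) as H.
  rewrite inv_diff_norm. apply Rgt_not_eq, Rdiv_lt_0_compat; nra.
Qed.

(** The dipole term gives the first two summands. Each arctangent gives a rotation about the center
    of the cylinder, since the inverse point lies on the ray through the vortex; its rate simplifies
    to [lam1 / (rho - Rad^2)] for the image vortex. *)
Lemma grad_phi_xE :
  grad_phi_x Rad lam lam1 s =
  - (Rad ^ 2 / red_rho s) * v1 s
  + 2 * Rad ^ 2 * (x1 s * v1 s + y1 s * v2 s) / red_rho s ^ 2 * x1 s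
  - (lam1 / (red_rho s - Rad ^ 2) - lam / red_rho s) * y1 s.
Proof.
  pose proof (phase_space_rho _ _ HRad Hphase) as H.
  assert (H0 : x1 s ^ 2 + y1 s ^ 2 <> 0) by (unfold red_rho in H; nra).
  pose proof inv_diff_norm_neq_0 as H1.
  apply is_derive_unique. unfold phi_tilde.
  set (xi := inv_x Rad s) in *. set (yi := inv_y Rad s) in *.
  evar_last.
  - apply @is_derive_plus; [apply @is_derive_minus |].
    + instantiate (1 := - (Rad ^ 2 / red_rho s) * v1 s
        + 2 * Rad ^ 2 * (x1 s * v1 s + y1 s * v2 s) / red_rho s ^ 2 * x1 s).
      auto_derive; [intuition; apply H0; nra |].
      unfold red_rho. field. auto.
    + apply is_derive_scal, is_derive_arctan_branch_x, H0.
    + apply is_derive_scal.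
      (* The inverse point is frozen, so the image term is a translated branch and the chain rule
         has inner derivative 1. *)
      apply (is_derive_comp (fun u => arctan_branch (x1 s - xi) u (y1 s - yi))
               (fun x => x - xi)).
      * now apply is_derive_arctan_branch_x.
      * auto_derive; [exact I | reflexivity].
  - unfold xi, yi. rewrite inv_diff_norm.
    unfold minus, plus, opp, scal; simpl; unfold mult; simpl.
    unfold inv_y. fold (red_rho s). unfold red_rho in *. field. nra.
Qed.

Lemma grad_phi_yE :
  grad_phi_y Rad lam lam1 s =
  - (Rad ^ 2 / red_rho s) * v2 s
  + 2 * Rad ^ 2 * (x1 s * v1 s + y1 s * v2 s) / red_rho s ^ 2 * y1 s
  + (lam1 / (red_rho s - Rad ^ 2) - lam / red_rho s) * x1 s.
Proof.
  pose proof (phase_space_rho _ _ HRad Hphase) as H.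
  assert (H0 : x1 s ^ 2 + y1 s ^ 2 <> 0) by (unfold red_rho in H; nra).
  pose proof inv_diff_norm_neq_0 as H1.
  apply is_derive_unique. unfold phi_tilde.
  set (xi := inv_x Rad s) in *. set (yi := inv_y Rad s) in *.
  evar_last.
  - apply @is_derive_plus; [apply @is_derive_minus |].
    + instantiate (1 := - (Rad ^ 2 / red_rho s) * v2 s
        + 2 * Rad ^ 2 * (x1 s * v1 s + y1 s * v2 s) / red_rho s ^ 2 * y1 s).
      auto_derive; [intuition; apply H0; nra |].
      unfold red_rho. field. auto.
    + apply is_derive_scal, is_derive_arctan_branch_y, H0.
    + apply is_derive_scal.
      apply (is_derive_comp (fun u => arctan_branch (x1 s - xi) (x1 s - xi) u)
               (fun y => y - yi)).
      * now apply is_derive_arctan_branch_y.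
      * auto_derive; [exact I | reflexivity].
  - unfold xi, yi. rewrite inv_diff_norm.
    unfold minus, plus, opp, scal; simpl; unfold mult; simpl.
    unfold inv_x. fold (red_rho s). unfold red_rho in *. field. nra.
Qed.

End Gradient.

(** * The vortex equation as a linear equation with coefficients in the reduced variables *)

Definition growth_rate (Rad a p1 rho : R) : R :=
  (Rad ^ 2 / rho - 1) * p1 / (a * rho).
(** [growth_rate] and [angular_rate] are the real and imaginary parts of [z' / z]. The dipole term
    reflects [w] in the direction of [z], whence the opposite signs of [Rad^2 / rho] relative to the
    1 coming from [-w]. *)
Definition angular_rate (Rad a lam lam1 p2 rho : R) : R :=
  lam1 / (rho - Rad ^ 2) - lam / rho - (1 + Rad ^ 2 / rho) * p2 / (a * rho).

Section Solution.

Variables (Rad a lam lam1 : R) (s : R -> state).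
Hypotheses (HRad : 0 < Rad) (Ha : 0 < a) (Hs : is_solution Rad a lam lam1 s).

Let alpha (t : R) : R := growth_rate Rad a (red_p1 a (s t)) (red_rho (s t)).
Let beta (t : R) : R :=
  angular_rate Rad a lam lam1 (red_p2 a (s t)) (red_rho (s t)).

Lemma solution_rho (t : R) : Rad ^ 2 < red_rho (s t).
Proof. apply phase_space_rho; [assumption | apply (sol_phase _ _ _ _ _ Hs)]. Qed.

Lemma solution_rho_neq_0 (t : R) : red_rho (s t) <> 0.
Proof. pose proof (solution_rho t). nra. Qed.

Lemma is_derive_x1 (t : R) :
  is_derive (fun u => x1 (s u)) t (alpha t * x1 (s t) - beta t * y1 (s t)).
Proof.
  pose proof (solution_rho t) as H.
  evar_last; [apply (Defs.sol_x1 _ _ _ _ _ Hs t) |].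
  rewrite grad_phi_xE by (apply (sol_phase _ _ _ _ _ Hs) || assumption).
  unfold alpha, beta, growth_rate, angular_rate, red_p1, red_p2, red_rho in *.
  field. repeat split; nra.
Qed.

Lemma is_derive_y1 (t : R) :
  is_derive (fun u => y1 (s u)) t (beta t * x1 (s t) + alpha t * y1 (s t)).
Proof.
  pose proof (solution_rho t) as H.
  evar_last; [apply (sol_y1 _ _ _ _ _ Hs t) |].
  rewrite grad_phi_yE by (apply (sol_phase _ _ _ _ _ Hs) || assumption).
  unfold alpha, beta, growth_rate, angular_rate, red_p1, red_p2, red_rho in *.
  field. repeat split; nra.
Qed.

Lemma ex_derive_inv_x (t : R) : ex_derive (fun u => inv_x Rad (s u)) t.
Proof.
  pose proof (ex_intro _ _ (is_derive_x1 t)) as Hx.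
  pose proof (ex_intro _ _ (is_derive_y1 t)) as Hy.
  pose proof (solution_rho_neq_0 t) as H. unfold red_rho in H.
  unfold inv_x. apply ex_derive_mult; [apply ex_derive_div | assumption].
  - apply ex_derive_const.
  - apply @ex_derive_plus; apply ex_derive_pow; assumption.
  - assumption.
Qed.

Lemma ex_derive_inv_y (t : R) : ex_derive (fun u => inv_y Rad (s u)) t.
Proof.
  pose proof (ex_intro _ _ (is_derive_x1 t)) as Hx.
  pose proof (ex_intro _ _ (is_derive_y1 t)) as Hy.
  pose proof (solution_rho_neq_0 t) as H. unfold red_rho in H.
  unfold inv_y. apply ex_derive_mult; [apply ex_derive_div | assumption].
  - apply ex_derive_const.
  - apply @ex_derive_plus; apply ex_derive_pow; assumption.
  - assumption.
Qed.

(** * First integrals, center of vorticity and recovery of the velocity *)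

Lemma integral_P_constant (t u : R) :
  integral_P Rad a lam lam1 (s t) = integral_P Rad a lam lam1 (s u).
Proof.
  apply (derive_zero_constant (fun t => integral_P Rad a lam lam1 (s t))).
  clear t u; intros t. unfold integral_P.
  evar_last.
  - apply @is_derive_plus; [apply @is_derive_minus |]; apply is_derive_scal.
    + apply Derive_correct, (sol_v1_ex _ _ _ _ _ Hs).
    + apply (sol_yc _ _ _ _ _ Hs).
    + apply @is_derive_minus; apply Derive_correct.
      * apply ex_derive_inv_y.
      * eexists; apply is_derive_y1.
  (* The derivative of [P] is the equation for [v1] with all terms on one side. *)
  - pose proof (sol_v1 _ _ _ _ _ Hs t).
    unfold minus, plus, opp; simpl. lra.
Qed.

Lemma integral_Q_constant (t u : R) :
  integral_Q Rad a lam lam1 (s t) = integral_Q Rad a lam lam1 (s u).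
Proof.
  apply (derive_zero_constant (fun t => integral_Q Rad a lam lam1 (s t))).
  clear t u; intros t. unfold integral_Q.
  evar_last.
  - apply @is_derive_minus; [apply @is_derive_plus |]; apply is_derive_scal.
    + apply Derive_correct, (sol_v2_ex _ _ _ _ _ Hs).
    + apply (sol_xc _ _ _ _ _ Hs).
    + apply @is_derive_minus; apply Derive_correct.
      * apply ex_derive_inv_x.
      * eexists; apply is_derive_x1.
  - pose proof (sol_v2 _ _ _ _ _ Hs t).
    unfold minus, plus, opp; simpl. lra.
Qed.

Lemma center_of_vorticity_exists :
  lam <> 0 -> exists O, is_center_of_vorticity Rad a lam lam1 s O.
Proof.
  intros Hlam.
  exists (integral_Q Rad a lam lam1 (s 0) / lam,
          - integral_P Rad a lam lam1 (s 0) / lam).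
  intros t. rewrite (integral_P_constant 0 t), (integral_Q_constant 0 t).
  unfold integral_P, integral_Q, inv_x, inv_y; simpl.
  (* Hiding the common factor [Rad^2 / rho] leaves [lam <> 0] as the only side condition. *)
  set (k := Rad * (Rad * 1) / _).
  split; field; assumption.
Qed.

(** The product of [w] with the conjugate of [z] is [(p1 + i p2) / a]; multiplying by [z / rho]
    recovers [w]. *)
Lemma v1_red (t : R) :
  v1 (s t) = (x1 (s t) * red_p1 a (s t) - y1 (s t) * red_p2 a (s t))
             / (a * red_rho (s t)).
Proof.
  pose proof (solution_rho_neq_0 t) as H.
  unfold red_p1, red_p2, red_rho in *. field. split; nra.
Qed.

Lemma v2_red (t : R) :
  v2 (s t) = (y1 (s t) * red_p1 a (s t) + x1 (s t) * red_p2 a (s t))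
             / (a * red_rho (s t)).
Proof.
  pose proof (solution_rho_neq_0 t) as H.
  unfold red_p1, red_p2, red_rho in *. field. split; nra.
Qed.

(** * Rotation of the vortex vector over one period *)

Variable T : R.
Hypotheses (Hp1 : forall t, red_p1 a (s (t + T)) = red_p1 a (s t))
           (Hp2 : forall t, red_p2 a (s (t + T)) = red_p2 a (s t))
           (Hrho : forall t, red_rho (s (t + T)) = red_rho (s t)).

(** [shift_dot] and [shift_cross] are the real and imaginary parts of [z (t + T) / z t]. *)
Let shift_dot (t : R) : R :=
  (x1 (s (t + T)) * x1 (s t) + y1 (s (t + T)) * y1 (s t)) / red_rho (s t).
Let shift_cross (t : R) : R :=
  (y1 (s (t + T)) * x1 (s t) - x1 (s (t + T)) * y1 (s t)) / red_rho (s t).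

(** The rates at [t + T] equal those at [t], so the shifted vector solves the same linear equation
    as the original one. *)
Lemma is_derive_x1_shift (t : R) :
  is_derive (fun u => x1 (s (u + T))) t
    (alpha t * x1 (s (t + T)) - beta t * y1 (s (t + T))).
Proof.
  evar_last.
  - apply (is_derive_comp (fun u => x1 (s u)) (fun u => u + T)).
    + apply is_derive_x1.
    + auto_derive; [exact I | reflexivity].
  - unfold alpha, beta. rewrite Hp1, Hp2, Hrho.
    unfold scal; simpl; unfold mult; simpl. ring.
Qed.

Lemma is_derive_y1_shift (t : R) :
  is_derive (fun u => y1 (s (u + T))) t
    (beta t * x1 (s (t + T)) + alpha t * y1 (s (t + T))).
Proof.
  evar_last.
  - apply (is_derive_comp (fun u => y1 (s u)) (fun u => u + T)).
    + apply is_derive_y1.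
    + auto_derive; [exact I | reflexivity].
  - unfold alpha, beta. rewrite Hp1, Hp2, Hrho.
    unfold scal; simpl; unfold mult; simpl. ring.
Qed.

(** Two solutions of one complex linear equation of first order have a constant quotient. *)
Lemma shift_dot_derive (t : R) : is_derive shift_dot t 0.
Proof.
  pose proof (is_derive_x1 t) as Hx. pose proof (is_derive_y1 t) as Hy.
  pose proof (is_derive_x1_shift t) as HX. pose proof (is_derive_y1_shift t) as HY.
  pose proof (solution_rho_neq_0 t) as H.
  unfold shift_dot, red_rho in *.
  evar_last.
  - apply @is_derive_div; [| | exact H].
    + apply @is_derive_plus; apply @is_derive_mult; try eassumption;
        intros; apply Rmult_comm.
    + apply @is_derive_plus; apply is_derive_pow; eassumption.
  - unfold plus, mult; simpl. field. nra.
Qed.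

Lemma shift_cross_derive (t : R) : is_derive shift_cross t 0.
Proof.
  pose proof (is_derive_x1 t) as Hx. pose proof (is_derive_y1 t) as Hy.
  pose proof (is_derive_x1_shift t) as HX. pose proof (is_derive_y1_shift t) as HY.
  pose proof (solution_rho_neq_0 t) as H.
  unfold shift_cross, red_rho in *.
  evar_last.
  - apply @is_derive_div; [| | exact H].
    + apply @is_derive_minus; apply @is_derive_mult; try eassumption;
        intros; apply Rmult_comm.
    + apply @is_derive_plus; apply is_derive_pow; eassumption.
  - unfold minus, plus, opp, mult; simpl. field. nra.
Qed.

Lemma vortex_shift_rotation :
  exists theta, forall t,
    x1 (s (t + T)) = cos theta * x1 (s t) - sin theta * y1 (s t) /\
    y1 (s (t + T)) = sin theta * x1 (s t) + cos theta * y1 (s t).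
Proof.
  destruct (unit_circle_angle (shift_dot 0) (shift_cross 0)) as [theta [Hc Hd]].
  - pose proof (solution_rho_neq_0 0) as H. pose proof (Hrho 0) as HT.
    (* The squared modulus of the quotient is the ratio of the two values of [rho], which is 1 by
       periodicity. *)
    replace (shift_dot 0 ^ 2 + shift_cross 0 ^ 2)
      with (red_rho (s (0 + T)) / red_rho (s 0)).
    + rewrite HT. now field.
    + unfold shift_dot, shift_cross, red_rho in *. field. assumption.
  - exists theta. intros t. rewrite Hc, Hd.
    (* The quotient is moved from time 0 to time [t], where multiplying it by [z t] gives
       [z (t + T)]. *)
    rewrite (derive_zero_constant _ shift_dot_derive 0 t).
    rewrite (derive_zero_constant _ shift_cross_derive 0 t).
    pose proof (solution_rho_neq_0 t) as H.
    unfold shift_dot, shift_cross, red_rho in *. split; field; assumption.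
Qed.

End Solution.

(** * Passage to the rotating frame *)

Lemma rotating_coords_shift (O : R * R) (omega t T : R) (q q' : R * R) :
  fst q' - fst O
    = cos (omega * T) * (fst q - fst O) - sin (omega * T) * (snd q - snd O) ->
  snd q' - snd O
    = sin (omega * T) * (fst q - fst O) + cos (omega * T) * (snd q - snd O) ->
  rotating_coords O omega (t + T) q' = rotating_coords O omega t q.
Proof.
  intros Hx Hy. unfold rotating_coords. rewrite Hx, Hy.
  rewrite Rmult_plus_distr_l, cos_plus, sin_plus.
  pose proof (sin2_cos2 (omega * T)) as H. unfold Rsqr in H.
  set (C := cos (omega * T)) in *. set (S := sin (omega * T)) in *.
  set (X := fst q - fst O). set (Y := snd q - snd O).
  set (c := cos (omega * t)). set (d := sin (omega * t)).
  f_equal.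
  (* The turn of the axes cancels the turn of the point up to the factor [S * S + C * C = 1]. *)
  - transitivity ((S * S + C * C) * (c * X + d * Y)); [ring | rewrite H; ring].
  - transitivity ((S * S + C * C) * (- d * X + c * Y)); [ring | rewrite H; ring].
Qed.

Theorem mainTheorem6
  (Rad a lam lam1 : R)
  (HRad : 0 < Rad) (Ha : 0 < a) (Hlam1 : lam1 <> 0) (Hlam : lam <> 0)
  (s : R -> state) (Hs : is_solution Rad a lam lam1 s)
  (Hper : exists T : R,
      periodic T (fun t => red_p1 a (s t)) /\
      periodic T (fun t => red_p2 a (s t)) /\
      periodic T (fun t => red_rho (s t))) :
  exists (O : R * R) (omega : R),
    is_center_of_vorticity Rad a lam lam1 s O /\
    exists T' : R,
      periodic T' (fun t => rotating_coords O omega t (cylinder_pos (s t))) /\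
      periodic T' (fun t => rotating_coords O omega t (vortex_pos (s t))).
Proof.
  destruct Hper as [T [[HT Hp1] [[_ Hp2] [_ Hrho]]]].
  destruct (center_of_vorticity_exists _ _ _ _ _ HRad Ha Hs Hlam) as [O HO].
  destruct (vortex_shift_rotation _ _ _ _ _ HRad Ha Hs T Hp1 Hp2 Hrho)
    as [theta Hrot].
  assert (Hang : theta / T * T = theta) by (field; lra).
  assert (Hcenter : forall t,
    xc (s (t + T)) - fst O = cos theta * (xc (s t) - fst O)
                             - sin theta * (yc (s t) - snd O) /\
    yc (s (t + T)) - snd O = sin theta * (xc (s t) - fst O)
                             + cos theta * (yc (s t) - snd O)).
  (* [P = Q = 0] at the center of vorticity, solved for the position of the cylinder. *)
  { assert (Hrel : forall t,
      xc (s t) - fst O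
        = (- a * v2 (s t) + lam1 * (inv_x Rad (s t) - x1 (s t))) / lam /\
      yc (s t) - snd O
        = (a * v1 (s t) + lam1 * (inv_y Rad (s t) - y1 (s t))) / lam).
    { intros t. destruct (HO t) as [HP HQ].
      unfold integral_P in HP; unfold integral_Q in HQ; simpl in HP, HQ.
      change (inv_x Rad (move_origin O (s t))) with (inv_x Rad (s t)) in HQ.
      change (inv_y Rad (move_origin O (s t))) with (inv_y Rad (s t)) in HP.
      split; apply (Rmult_eq_reg_l lam); auto; field_simplify; auto; lra. }
    intros t.
    destruct (Hrel t) as [-> ->]. destruct (Hrel (t + T)) as [-> ->].
    (* Once velocity and inverse point are expressed through [z], the position is [z] times a
       complex coefficient of period [T], so it turns by [theta] together with [z]. *)
    unfold inv_x, inv_y. fold (red_rho (s t)) (red_rho (s (t + T))).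
    rewrite !(v1_red _ _ _ _ _ HRad Ha Hs), !(v2_red _ _ _ _ _ HRad Ha Hs).
    rewrite Hp1, Hp2, Hrho.
    destruct (Hrot t) as [-> ->].
    pose proof (solution_rho_neq_0 _ _ _ _ _ HRad Hs t) as H.
    split; field; repeat split; auto; lra. }
  (* With this angular velocity the frame turns by exactly [theta] in the time [T]. *)
  exists O, (theta / T). split; [exact HO |].
  exists T. split; split; try exact HT; intros t; apply rotating_coords_shift;
    rewrite Hang; simpl; destruct (Hrot t) as [HX HY];
    destruct (Hcenter t) as [HXc HYc]; lra.
Qed.
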